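(* $\diamondsuit_{2^{<\omega_1}}$ holds in $\mathsf{ZFC}$.
   Context: $2^{<\omega_1}$ is the tree of all functions $s:\alpha\to 2$ with $\alpha<\omega_1$, ordered by inclusion (end-extension). For a tree $T$ with root $\emptyset$ and $t\in T$, $t{\downarrow}=\{s\in T\mid s<_T t\}$. An antichain is a set of pairwise incomparable nodes. A set $U\subseteq T$ is special if it is a union of at most countably many antichains; otherwise it is nonspecial. For $X\subseteq T$, a map $f:X\to T$ is regressive if $f(t)<_T t$ for all $t\in X\setminus\{\emptyset\}$. For $T$ of height $\omega_1$, $NS^T$ is the ideal of all $B\subseteq T$ for which there is a regressive $f:B\to T$ such that $f^{-1}(\{t\})$ is special for every $t\in T$. For a nonspecial tree $T$ of height $\omega_1$, $\diamondsuit_T$ asserts that there is a sequence $(D_t\mid t\in T)$ with $D_t\subseteq t{\downarrow}$ for all $t\in T$ such that for every $X\subseteq T$, $\{t\in T\mid X\cap t{\downarrow}=D_t\}\notin NS^T$. *)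

(* Defs.v *)
From mathcomp Require Import all_boot.
From mathcomp Require Import boolp classical_sets functions cardinality wochoice.
Set Implicit Arguments.
Unset Strict Implicit.
Unset Printing Implicit Defensive.
Local Open Scope classical_set_scope.

Definition well_ordered (T : Type) (lt : T -> T -> Prop) (D : set T) :=
  forall A : set T, A `<=` D -> A !=set0 ->
    exists2 m, A m & forall a, A a -> a = m \/ lt m a.

(* A representation of the ordinal omega_1: an uncountable well-order all of
   whose proper initial segments are countable.  This determines the order up
   to isomorphism; [omega1_inhabited] below shows that one exists. *)
Record omega1 := Omega1 {
  ord :> Type;
  olt : ord -> ord -> Prop;
  olt_irr : forall a, ~ olt a a;
  olt_trans : forall a b c, olt a b -> olt b c -> olt a c;
  olt_wo : well_ordered olt [set: ord];
  olt_countable : forall a, countable [set b | olt b a];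
  ord_uncountable : ~ countable [set: ord] }.

Record rooted_tree := RootedTree {
  node :> Type;
  tlt : node -> node -> Prop;
  root : node;
  tlt_irr : forall t, ~ tlt t t;
  tlt_trans : forall s t u, tlt s t -> tlt t u -> tlt s u;
  tlt_wo : forall t, well_ordered tlt [set s | tlt s t];
  root_least : forall t, t = root \/ tlt root t }.

Definition down (T : rooted_tree) (t : T) : set T := [set s | tlt s t].

(* The proper initial segments of [W] are the countable ordinals, so this says
   that the order types of the sets [down t] are exactly those ordinals. *)
Definition height_omega1 (W : omega1) (T : rooted_tree) :=
  let same_type (a : W) (t : T) :=
    exists2 f : W -> T, set_bij [set b | olt b a] (down t) f &
      forall b c, olt b a -> olt c a -> (olt b c <-> tlt (f b) (f c)) in
  (forall t, exists a, same_type a t) /\ (forall a, exists t, same_type a t).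

Definition antichain (T : rooted_tree) (A : set T) :=
  forall s t, A s -> A t -> s <> t -> ~ (tlt s t \/ tlt t s).

Definition special (T : rooted_tree) (U : set T) :=
  exists F : set (set T),
    [/\ countable F, (forall A, F A -> antichain A) & U = \bigcup_(A in F) A].

(* Maps on [X] are represented by total maps whose values off [X] are ignored. *)
Definition regressive (T : rooted_tree) (X : set T) (f : T -> T) :=
  forall t, X t -> t <> root T -> tlt (f t) t.

Definition NS (T : rooted_tree) : set (set T) :=
  [set B | exists f : T -> T,
     regressive B f /\ forall t, special (B `&` f @^-1` [set t])].

Definition diamond (T : rooted_tree) :=
  exists D : T -> set T,
    (forall t, D t `<=` down t) /\
    forall X : set T, ~ @NS T [set t | X `&` down t = D t].

(* [diamond] need not require [T] to be nonspecial: it implies it. *)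
Lemma diamond_nonspecial (T : rooted_tree) : diamond T -> ~ special [set: T].
Proof.
move=> [D [_ dD]] [F [Fc Fa FT]]; apply: (dD set0); exists (fun=> root T).
split=> [t _ tr|t]; first by case: (root_least t).
set B := _ `&` _; exists [set A `&` B | A in F]; split.
- exact: (sub_countable (card_image_le _ _)).
- by move=> _ [A FA <-] x y [Ax _] [Ay _]; apply: (Fa A FA).
- rewrite eqEsubset; split=> x.
    move=> Bx; have : [set: T] x by [].
    by rewrite FT => -[A FA Ax]; exists (A `&` B) => //; exists A.
  by move=> [_ [A FA <-] []].
Qed.

Section BinaryTree.
Variable W : omega1.

(* Functions s : alpha -> 2 with alpha < omega_1, given by their graphs: [s] is
   a partial function on [W] whose domain is the initial segment below some
   [a : W], that is, a countable ordinal. *)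
Definition binseq :=
  {s : W -> option bool | exists a, forall b, s b <> None <-> olt b a}.

Definition binseq_sub (s t : binseq) :=
  forall b i, sval s b = Some i -> sval t b = Some i.

Definition binseq_lt (s t : binseq) := binseq_sub s t /\ s <> t.

Lemma olt_total (a b : W) : [\/ olt a b, a = b | olt b a].
Proof.
have [|m mab lem] := @olt_wo W [set a; b] (@subsetT _ _); first by exists a; left.
have [a_ b_] : (a = m \/ olt m a) /\ (b = m \/ olt m b).
  by split; apply: lem; [left|right].
case: mab a_ b_ => -> [e|h] [e'|h']; by [apply: Or31|apply: Or32|apply: Or33].
Qed.

Lemma binseq_eq (s t : binseq) : sval s =1 sval t -> s = t.
Proof.
by case: s t => s hs [t ht] /= /funext st; subst t; congr exist; apply: Prop_irrelevance.
Qed.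

Definition len (s : binseq) : W := projT1 (cid (svalP s)).

Lemma lenP (s : binseq) b : sval s b <> None <-> olt b (len s).
Proof. exact: (projT2 (cid (svalP s))). Qed.

Lemma len_le (s : binseq) a :
  (forall b, sval s b <> None <-> olt b a) -> len s = a.
Proof.
move=> sa; have [h|//|h] := olt_total (len s) a.
- by have /sa/lenP/olt_irr := h.
- by have /lenP/sa/olt_irr := h.
Qed.

Definition restr_fun (s : binseq) (a : W) b :=
  if `[< olt b a >] then sval s b else None.

Lemma restr_proof s a : exists c, forall b, restr_fun s a b <> None <-> olt b c.
Proof.
rewrite /restr_fun; have [h|h|h] := olt_total a (len s).
- exists a => b; case: asboolP => // ba; split=> // _.
  by apply/lenP; apply: olt_trans ba h.
- exists a => b; case: asboolP => // ba; split=> // _.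
  by apply/lenP; rewrite -h.
- exists (len s) => b; case: asboolP => [ba|nba]; first exact: lenP.
  by split=> // bs; case: nba; apply: olt_trans bs h.
Qed.

Definition restr s a : binseq := exist _ (restr_fun s a) (restr_proof s a).

Lemma len_restr s a : olt a (len s) -> len (restr s a) = a.
Proof.
move=> al; apply: len_le => b /=; rewrite /restr_fun; case: asboolP => // ba.
by split=> // _; apply/lenP; apply: olt_trans ba al.
Qed.

Lemma sub_restr s t : binseq_sub s t -> s = restr t (len s).
Proof.
move=> st; apply: binseq_eq => b /=; rewrite /restr_fun; case: asboolP.
  move=> /lenP; case E: (sval s b) => [i|] // _; exact/esym/st.
by move=> nb; case E: (sval s b) => [i|] //; case: nb; apply/lenP; rewrite E.
Qed.

Lemma binseq_ltE s t :
  binseq_lt s t <-> olt (len s) (len t) /\ s = restr t (len s).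
Proof.
split=> [[st nst]|[lst sE]].
  have sE := sub_restr st; split=> //.
  have [//|e|/lenP h] := olt_total (len s) (len t).
    case: nst; rewrite sE e; apply: binseq_eq => b /=; rewrite /restr_fun.
    case: asboolP => // nb; case E: (sval t b) => [i|] //.
    by case: nb; apply/lenP; rewrite E.
  case E: (sval s (len t)) h => [i|] // _.
  by have /lenP/olt_irr : sval t (len t) <> None by rewrite (st _ _ E).
split=> [b i|st]; last by move: lst; rewrite st => /olt_irr.
by rewrite sE /= /restr_fun; case: asboolP.
Qed.

Lemma binseq_lt_restr (t : binseq) a b :
  olt a b -> olt b (len t) -> binseq_lt (restr t a) (restr t b).
Proof.
move=> ab bt; have ta := olt_trans ab bt.
apply/binseq_ltE; rewrite !len_restr//; split=> //; apply: binseq_eq => c /=.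
rewrite /restr_fun /= /restr_fun; case: asboolP => // ca.
by case: asboolP => // -[]; apply: olt_trans ca ab.
Qed.

Lemma binseq_lt_irr s : ~ binseq_lt s s.
Proof. by case. Qed.

Lemma binseq_lt_trans s t u : binseq_lt s t -> binseq_lt t u -> binseq_lt s u.
Proof.
move=> st tu; have [lst _] := iffLR (binseq_ltE _ _) st.
have [ltu _] := iffLR (binseq_ltE _ _) tu.
split=> [b i /st.1/tu.1//|su]; rewrite su in lst.
exact: (olt_irr (olt_trans lst ltu)).
Qed.

Lemma binseq_lt_wo t : well_ordered binseq_lt [set s | binseq_lt s t].
Proof.
move=> A At [x Ax].
have [|_ [m Am <-] mmin] := @olt_wo W (len @` A) (@subsetT _ _).
  by exists (len x), x.
exists m => // s As; have [_ sE] := iffLR (binseq_ltE _ _) (At s As).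
have [lst _] := iffLR (binseq_ltE _ _) (At s As).
have [_ mE] := iffLR (binseq_ltE _ _) (At m Am).
have [e|ms] : len s = len m \/ olt (len m) (len s) by apply: mmin; exists s.
  by left; rewrite sE mE e.
by right; rewrite sE mE; apply: binseq_lt_restr.
Qed.

Lemma empty_proof : exists a : W, forall b, (None : option bool) <> None <-> olt b a.
Proof.
have [|m _ mmin] := @olt_wo W setT (@subsetT _ _).
  apply/set0P/eqP => W0; apply: (@ord_uncountable W); rewrite W0; exact: countable0.
exists m => b; split=> // bm; case: (mmin b I) => [bE|mb].
  by move: bm; rewrite bE => /olt_irr.
by case: (olt_irr (olt_trans bm mb)).
Qed.

Definition empty_binseq : binseq := exist _ (fun=> None) empty_proof.

Lemma empty_least t : t = empty_binseq \/ binseq_lt empty_binseq t.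
Proof.
by have [|te] := pselect (t = empty_binseq); [left|right; split=> // /esym].
Qed.

(* The tree 2^{<omega_1}, ordered by inclusion. *)
Definition binary_tree : rooted_tree :=
  RootedTree binseq_lt_irr binseq_lt_trans binseq_lt_wo empty_least.

Lemma binary_tree_height : height_omega1 W binary_tree.
Proof.
have key (t : binary_tree) : exists2 f : W -> binary_tree,
    set_bij [set b | olt b (len t)] (down t) f &
    forall b c, olt b (len t) -> olt c (len t) -> (olt b c <-> tlt (f b) (f c)).
  exists (restr t).
    split=> [b /= bt|b c|s /binseq_ltE[lst sE]].
    - by apply/binseq_ltE; rewrite len_restr.
    - rewrite !inE /= => bt ct e.
      by rewrite -(len_restr bt) -(len_restr ct) e.
    - by exists (len s) => //; rewrite -sE.
  move=> b c bt ct; split=> [bc|/binseq_ltE[]].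
    exact: binseq_lt_restr.
  by rewrite !len_restr.
split=> [t|a]; first by exists (len t); apply: key.
have ha : exists c, forall b,
    (if `[< olt b a >] then Some true else None) <> None <-> olt b c.
  by exists a => b; case: asboolP.
pose t : binseq := exist _ (fun b => if `[< olt b a >] then Some true else None) ha.
have <- : len t = a by apply: len_le => b /=; case: asboolP.
by exists t; apply: key.
Qed.

End BinaryTree.

Lemma cantor_uncountable : ~ countable [set: nat -> bool].
Proof.
case/countable_injP => f; rewrite /set_inj => finj.
pose g n := `[< forall x : nat -> bool, f x = n -> x n = false >].
have [gt|gf] := boolP (g (f g)).
  by move/asboolP: (gt) => /(_ g erefl); rewrite gt.
move/asboolP: (gf); apply=> x xg.
have -> : x = g by apply: finj; rewrite ?inE.
exact: negbTE.
Qed.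

Lemma omega1_inhabited : inhabited omega1.
Proof.
pose T : eqType := {classic (nat -> bool)}.
have [R Rwo] := well_ordering_principle T.
have Rch := @wo_chainW T R predT (fun A _ => Rwo A).
have Rtot x y : R x y || R y x by exact: Rch.
have Ranti x y : R x y -> R y x -> x = y.
  move=> xy yx.
  by apply: (@wo_chain_antisymmetric T R predT (fun A _ => Rwo A)); rewrite ?xy.
have Rmin (A : set T) : A !=set0 -> exists2 m, A m & forall a, A a -> R m a.
  move=> [x Ax]; have [|m [[]]] := Rwo (fun y => `[< A y >]).
    by exists x; rewrite unfold_in; apply/asboolP.
  rewrite unfold_in => /asboolP Am lb _; exists m => // a Aa; apply: lb.
  by rewrite unfold_in; apply/asboolP.
have Rtrans x y z : R x y -> R y z -> R x z.
  move=> xy yz; have [|m mA lm] := Rmin [set u | [\/ u = x, u = y | u = z]].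
    by exists x; apply: Or31.
  have mx : R m x by apply: lm; apply: Or31.
  have my : R m y by apply: lm; apply: Or32.
  have mz : R m z by apply: lm; apply: Or33.
  case: mA => mE; rewrite mE in mx my mz => //.
  - by rewrite (Ranti _ _ xy mx).
  - by rewrite -(Ranti _ _ yz my).
pose lt (x y : T) := R x y /\ x <> y.
have lt_irr x : ~ lt x x by case.
have lt_trans x y z : lt x y -> lt y z -> lt x z.
  move=> [xy nxy] [yz nyz]; split; first exact: Rtrans yz.
  by move=> xz; apply: nyz; apply: Ranti => //; rewrite -xz.
have build (D : set T) : ~ countable D ->
    (forall a, D a -> countable [set b | D b /\ lt b a]) -> inhabited omega1.
  move=> Dunc Dc; pose o := {x | D x}.
  have o_eq (x y : o) : sval x = sval y -> x = y.
    by apply: eq_sig_hprop => ? ? ?; apply: Prop_irrelevance.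
  have img (A : set o) : countable A = countable (sval @` A).
    by apply/esym/card_le_eql/inj_card_eq => x y _ _; apply: o_eq.
  constructor; exists o (fun x y => lt (sval x) (sval y)).
  - by move=> x; apply: lt_irr.
  - by move=> x y z; apply: lt_trans.
  - move=> A _ [x Ax]; have [|_ [m Am <-] mm] := Rmin (sval @` A).
      by exists (sval x), x.
    exists m => // a Aa; have [am|am] := pselect (sval a = sval m).
      by left; apply: o_eq.
    by right; split; [apply: mm; exists a|move=> /esym].
  - move=> [a Da] /=; rewrite img.
    apply: sub_countable (Dc a Da); apply: subset_card_le => _ [[b Db] /= ba <-].
    by split.
  - rewrite img => h; apply: Dunc.
    apply: sub_countable h; apply: subset_card_le => x Dx.
    by exists (exist _ x Dx).
have [allc|] := pselect (forall a, countable [set b | lt b a]).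
  apply: (build setT) => [|a _]; first exact: cantor_uncountable.
  by apply: sub_countable (allc a); apply: subset_card_le => b [].
move=> /existsNP nc; have [a ac amin] := Rmin _ nc.
apply: (build [set b | lt b a]) => // b [ba nba].
apply: contrapT => bunc; apply: nba; apply: Ranti => //; apply: amin => bc.
by apply: bunc; apply: sub_countable bc; apply: subset_card_le => c [].
Qed.

(* Main.v *)
(* Let [D t] be the set of the restrictions of [t] to those [a] with
   [t a = 1].  Given [X], there is a cofinal branch [b : omega_1 -> 2] with
   [b a = 1] iff the restriction of [b] to [a] is in [X], and along it [D]
   guesses [X] at every node.  By pressing down, a regressive function has
   an uncountable fibre on the branch, whereas a special set meets a chain in a
   countable set. *)
From mathcomp Require Import all_boot.
From mathcomp Require Import boolp classical_sets functions cardinality.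
Require Import Defs.
Set Implicit Arguments.
Unset Strict Implicit.
Unset Printing Implicit Defensive.
Local Open Scope classical_set_scope.

Lemma countable_setU T (A B : set T) :
  countable A -> countable B -> countable (A `|` B).
Proof.
by move=> Ac Bc; rewrite -bigcup2E; apply: bigcup_countable => // -[|[|n]].
Qed.

Section Omega1.
Variable W : omega1.

Lemma olt_wf : well_founded (@olt W).
Proof.
move=> a; apply: contrapT => na.
have [||m nm min] := @olt_wo W [set x | ~ Acc (@olt W) x]; first by [].
  by exists a.
apply: nm; constructor=> b bm; apply: contrapT => nb.
case: (min b nb) => [e|mb]; first by move: bm; rewrite e => /olt_irr.
exact: olt_irr (olt_trans bm mb).
Qed.

Lemma omega1_nonempty : exists a : W, True.
Proof.
apply: contrapT => W0; apply: (@ord_uncountable W).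
suff -> : [set: W] = set0 by exact: countable0.
by apply/seteqP; split=> // a _; case: W0; exists a.
Qed.

(** If [A] were unbounded, the closed initial segments ending in [A] would cover [W] by countably
    many countable sets. *)
Lemma countable_bounded (A : set W) :
  countable A -> exists e, forall a, A a -> olt a e.
Proof.
move=> Ac; apply: contrapT => nb; apply: (@ord_uncountable W).
suff -> : [set: W] = \bigcup_(a in A) ([set a] `|` [set b | olt b a]).
  apply: bigcup_countable => // a _; apply: countable_setU => //.
  exact: olt_countable.
apply/seteqP; split=> // e _; apply: contrapT => ne.
apply: nb; exists e => a Aa; apply: contrapT => nae; apply: ne; exists a => //.
by have [//|ae|ea] := olt_total a e; [left|right].
Qed.

(** A weak Fodor lemma in contrapositive form. The element [b] only ensures that [a] is not least,
    where no map can be regressive. *)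
Lemma pressing_down (h : W -> W) :
  (forall c, countable [set a | h a = c /\ olt c a]) ->
  exists a b, olt b a /\ ~ olt (h a) a.
Proof.
move=> hc; apply: contrapT => nh.
have reg a b : olt b a -> olt (h a) a.
  by move=> ba; apply: contrapT => nha; apply: nh; exists a, b.
(* The fibres over points up to [d] are countably many countable sets, so [S d] has a strict bound
   [step d]. *)
pose S d := [set d] `|` \bigcup_(c in [set d] `|` [set c | olt c d])
  [set a | h a = c /\ olt c a].
have Sb d : exists e, forall a, S d a -> olt a e.
  apply: countable_bounded; apply: countable_setU => //.
  apply: bigcup_countable => //; apply: countable_setU => //.
  exact: olt_countable.
have [step stepP] := choice Sb.
have [d0 _] := omega1_nonempty.
pose d n := iter n step d0.
have [u du] : exists u, forall a, range d a -> olt a u.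
  exact: countable_bounded (card_image_le _ _).
(* [m] is the least strict bound of all [d n]. As [h m] is below [m], some [d n] is at least [h m],
   and then [d n.+1] exceeds [m], a contradiction. *)
have [||m dm min] := @olt_wo W [set u | forall n, olt (d n) u]; first by [].
  by exists u => n; apply: du; exists n.
have hm := reg _ _ (dm 0).
have [n ndn] : exists n, ~ olt (d n) (h m).
  apply/existsNP => /min [e|mh]; first by move: hm; rewrite e => /olt_irr.
  exact: olt_irr (olt_trans hm mh).
suff : olt m (d n.+1) by move=> mdn; apply: olt_irr (olt_trans mdn (dm n.+1)).
apply: stepP; right; exists (h m) => //.
by have [//|dh|hd] := olt_total (d n) (h m); [left|right].
Qed.

End Omega1.

Section Branch.
Variables (W : omega1) (X : set (binseq W)).

Definition branch_fun (a : W) (rec : forall b, olt b a -> binseq W) (b : W) :=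
  if pselect (olt b a) is left ba then Some `[< X (rec b ba) >] else None.

Lemma branch_proof a rec : exists c, forall b, @branch_fun a rec b <> None <-> olt b c.
Proof. by exists a => b; rewrite /branch_fun; case: pselect. Qed.

(** Each bit depends on a whole earlier node, so the recursion yields nodes rather than bits. *)
Definition branch : W -> binseq W :=
  Fix (@olt_wf W) (fun=> binseq W)
    (fun a rec => exist _ (branch_fun rec) (branch_proof rec)).

(** Apart from the cutoff, the value does not depend on [a]: the nodes cohere into one cofinal
    branch. *)
Lemma branchE a b :
  sval (branch a) b = if `[< olt b a >] then Some `[< X (branch b) >] else None.
Proof.
rewrite /branch Fix_eq /=; last first.
  move=> x f g fg; suff -> : f = g by [].
  by apply: functional_extensionality_dep => y; exact/funext/fg.
by rewrite /branch_fun; case: pselect => ba; [rewrite (asboolT ba)|rewrite (asboolF ba)].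
Qed.

Lemma len_branch a : len (branch a) = a.
Proof. by apply: len_le => b; rewrite branchE; case: asboolP. Qed.

Lemma branch_lt a b : olt a b -> binseq_lt (branch a) (branch b).
Proof.
move=> ab; split=> [c i|e].
  rewrite !branchE; case: (asboolP (olt c a)) => // ca.
  by rewrite (asboolT (olt_trans ca ab)).
by move: ab; rewrite -(len_branch a) e len_branch => /olt_irr.
Qed.

(** Restricting [branch a] to [len s] only lowers the cutoff in [branchE]. *)
Lemma lt_branch s a : binseq_lt s (branch a) ->
  olt (len s) a /\ s = branch (len s).
Proof.
move=> /binseq_ltE[]; rewrite len_branch => sa sE; split=> //.
apply: binseq_eq => b; rewrite {1}sE /= /restr_fun !branchE.
case: (asboolP (olt b (len s))) => // bs.
by rewrite (asboolT (olt_trans bs sa)).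
Qed.

(** Nodes of the branch are pairwise comparable, so an antichain contains at most one of them. *)
Lemma special_branch (U : set (binary_tree W)) :
  special U -> countable [set a | U (branch a)].
Proof.
move=> [F [Fc Fa ->]].
suff -> : [set a | (\bigcup_(A in F) A) (branch a)] =
    \bigcup_(A in F) [set a | A (branch a)].
  apply: bigcup_countable => // A FA; apply: finite_set_countable.
  have [[a Aa]|A0] := pselect (exists a, A (branch a)).
    apply: sub_finite_set (finite_set1 a) => b Ab /=.
    have ne x y : olt x y -> A (branch x) -> A (branch y) -> False.
      move=> xy Ax Ay; have xyT := branch_lt xy.
      by apply: (Fa A FA _ _ Ax Ay); [exact: xyT.2|left].
    by have [ba|//|ab] := olt_total b a; [case: (ne b a)|case: (ne a b)].
  suff -> : [set a | A (branch a)] = set0 by exact: finite_set0.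
  by apply/seteqP; split=> // a Aa; case: A0; exists a.
by [].
Qed.

End Branch.

Theorem theorem3p28 (W : omega1) : diamond (binary_tree W).
Proof.
exists (fun t => [set s | binseq_lt s t /\ sval t (len s) = Some true]).
split=> [t s [] //|X [f [freg fsp]]].
pose N := branch X.
have guess a : X `&` down (N a : binary_tree W) =
    [set s | binseq_lt s (N a) /\ sval (N a) (len s) = Some true].
  apply/seteqP; split=> s.
    move=> [Xs sa]; split=> //; have [la sE] := lt_branch sa.
    by rewrite branchE -sE asboolT // asboolT.
  move=> [sa]; have [la sE] := lt_branch sa.
  by rewrite branchE -sE asboolT // => -[/asboolP].
have [|a [b [ba]]] := @pressing_down W (fun a => len (f (N a))).
  move=> c; apply: sub_countable (special_branch X (fsp (N c))).
  apply: subset_card_le => a [ac ca]; split=> /=; first exact: guess.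
  (* A node below [N a] is determined by its length, so [f (N a)] is [N c] and [N a] lies in a
     special fibre of [f]. *)
  have /lt_branch[_] : binseq_lt (f (N a)) (N a); last by rewrite ac.
  apply: freg; first exact: guess.
  (* [N a] is not the root, since it is defined at [c]. *)
  by move=> /(congr1 (fun s => sval s c)); rewrite branchE asboolT.
apply; apply: (proj1 (lt_branch (freg _ (guess a) _))).
by move=> /(congr1 (fun s => sval s b)); rewrite branchE asboolT.
Qed.
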